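(* Consider $n\ge 2$ bidders in a repeated second price auction with value/bid grid $V=\{\frac1H,\frac2H,\dots,1\}$, where every bidder runs the learning algorithm consisting of $T_0$ rounds of pure uniform exploration followed by a $\gamma_t$-mean-based contextual learning algorithm. Suppose there is a constant $\tau>0$ with $\tau\le \frac{1}{H^{n-1}}$ and $g_i(v)\ge\tau$ for all $i\in[n]$ and $v\in V$ (thickness assumption). Suppose $T_0$ is large enough that $$\exp\left(-\frac{\tau^2T_0}{32n^2H^2}\right)\le\frac12\qquad\text{and}\qquad \gamma_t\le\frac{\tau}{8nH}\quad\text{for all } t\ge T_0 .$$ Then for every time $t>T_0$, every bidder $i$, and every fixed value $v\in V$, given $v_{i,t}=v$, bidder $i$ submits the truthful bid $b_{i,t}=v_{i,t}$ with probability at least $$p(t)=1-H\gamma_t-4\exp\left(-\frac{\tau^2T_0}{32n^2H^2}\right).$$ In particular $p(t)\to 1-4\exp\left(-\frac{\tau^2T_0}{32n^2H^2}\right)$ as $t\to\infty$.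
   Context: Setting. $H$ is a positive integer and $V=\{\frac1H,\frac2H,\dots,1\}$. There are $n$ bidders and rounds $t=1,2,\dots$; in each round one good is sold. Bidder $i$'s value $v_{i,t}\in V$ in round $t$ is drawn from a distribution $F_i$ on $V$, independently over rounds and across bidders, and bidder $i$ submits a bid $b_{i,t}\in V$ depending on $v_{i,t}$, past information and private randomness (independent across bidders). Write $b_{-i,t}$ for the bids of bidders other than $i$, $m_{i,t}=\max_{j\ne i}b_{j,t}$, and $z_{i,t}=\max_{j\neq i}v_{j,t}$. $G_i$ is the distribution of $z_{i,t}$ and $g_i$ its probability mass function on $V$. Second price auction. $u_{i,t}((b,b_{-i,t});v)$ denotes the utility of bidder $i$ in round $t$ when she has value $v$, bids $b$, and the others bid $b_{-i,t}$. It equals $v-m_{i,t}$ if bidder $i$ wins and $0$ otherwise; bidder $i$ wins if $b>m_{i,t}$, loses if $b<m_{i,t}$, and if $b=m_{i,t}$ the winner is chosen uniformly at random among the highest bidders. Mean-based contextual learning algorithm. Let $r_{a,t}(c)$ be the reward of action $a$ at time $t$ when the context is $c$, and $\sigma_{a,t}(c)=\sum_{s=1}^t r_{a,s}(c)$. An algorithm is $\gamma_t$-mean-based if whenever $\sigma_{a,t}(c)<\sigma_{b,t}(c)-\gamma_t t$, the probability that the algorithm plays action $a$ on round $t+1$, given context $c$, is at most $\gamma_t$. Here $(\gamma_t)$ is a sequence such that $\gamma_t t$ is increasing in $t$ and $\gamma_t\to0$ as $t\to\infty$. For bidder $i$ the context in round $t$ is her value, the actions are the bids in $V$, and the reward of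 bid $b$ in context $v$ at time $t$ is $u_{i,t}((b,b_{-i,t});v)$ (defined for every $v\in V$ and every $b\in V$ in every round, including exploration rounds). Bidders' algorithm with parameters $(\gamma_t,T_0)$. For $t=1,\dots,T_0$ each bidder chooses $b_{i,t}$ uniformly at random from $V$ (regardless of her value, independently across bidders and rounds). For $t>T_0$ she observes $v_{i,t}$ and chooses $b_{i,t}$ by a $\gamma_t$-mean-based contextual learning algorithm. All bidders share the same $\gamma_t$ and $T_0$. *)

(* Defs.v *)
From HB Require Import structures.
From mathcomp Require Import all_boot all_order all_algebra.
From mathcomp Require Import all_classical all_reals all_analysis.

Set Implicit Arguments.
Unset Strict Implicit.
Unset Printing Implicit Defensive.

Import Order.TTheory GRing.Theory Num.Theory.
Import numFieldNormedType.Exports.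

Local Open Scope ring_scope.

Record fdist (R : realType) (A : finType) := FDist {
  pmf :> A -> R;
  pmf_ge0 : forall a, 0 <= pmf a;
  pmf_sum1 : \sum_a pmf a = 1 }.

Definition prob (R : realType) (A : finType) (mu : A -> R) (E : pred A) : R :=
  \sum_(a | E a) mu a.

(* Law of a family of independent variables x i with respective laws mu i. *)
Definition indep_pmf (R : realType) (I A : finType) (mu : I -> A -> R)
    (x : {ffun I -> A}) : R :=
  \prod_i mu i (x i).

(** Contextual learning *)

(* O is what is recorded about one round, C the contexts, A the actions.  The
   list of past records is in chronological order.  The distribution returned
   is that of the next action given the past and the current context; the
   private randomness of the algorithm is integrated in it. *)
Definition learner (R : realType) (O C : Type) (A : finType) : Type :=
  seq O -> C -> fdist R A.

(* [r o c a] is the reward of action [a] in context [c] in a round with record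
   [o]; it is defined for all c and a, not only for those that occurred. *)
Definition cum_reward (R : realType) (O C : Type) (A : finType)
    (r : O -> C -> A -> R) (h : seq O) (c : C) (a : A) : R :=
  \sum_(o <- h) r o c a.

(* Here [size h] is the number t of rounds already played. *)
Definition mean_based (R : realType) (O C : Type) (A : finType)
    (gamma : nat -> R) (r : O -> C -> A -> R) (L : learner R O C A) : Prop :=
  forall (h : seq O) (c : C) (a b : A),
    cum_reward r h c a < cum_reward r h c b - gamma (size h) * (size h)%:R ->
    L h c a <= gamma (size h).

(** Second price auction *)

(* The index k : 'I_H stands for the element (k + 1) / H of V. *)
Definition grid (R : realType) (H : nat) (k : 'I_H) : R := k.+1%:R / H%:R.

Definition profile (n H : nat) : finType := {ffun 'I_n -> 'I_H}.

(* The neutral element 0 is below all of V, hence irrelevant when n >= 2. *)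
Definition max_others (R : realType) (n H : nat) (i : 'I_n)
    (x : profile n H) : R :=
  \big[Num.max/0]_(j | j != i) grid R (x j).

Definition highest (n H : nat) (b : profile n H) : {set 'I_n} :=
  [set j | [forall k, (b k <= b j)%N]].

(* A tie-breaking outcome names the winner for every bid profile, so that the
   counterfactual bids of a round also have a utility. *)
Definition winner_rule (n H : nat) : finType :=
  {w : {ffun profile n H -> 'I_n} | [forall b, w b \in highest b]}.

Definition winner (n H : nat) (w : winner_rule n H) (b : profile n H) : 'I_n :=
  val w b.

(* Only the marginals are prescribed: nothing is assumed on how the winners
   for different bid profiles are correlated within a round. *)
Definition uniform_ties (R : realType) (n H : nat)
    (D : fdist R (winner_rule n H)) : Prop :=
  forall (b : profile n H) (j : 'I_n), j \in highest b ->
    prob D (fun w => winner w b == j) = #|highest b|%:R^-1.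

(* Values, bids and tie-breaking outcome of one round. *)
Definition round (n H : nat) : finType :=
  (profile n H * profile n H * winner_rule n H)%type.

Definition values (n H : nat) (x : round n H) : profile n H := x.1.1.
Definition bids (n H : nat) (x : round n H) : profile n H := x.1.2.
Definition ties (n H : nat) (x : round n H) : winner_rule n H := x.2.

Definition set_bid (n H : nat) (b : profile n H) (i : 'I_n) (a : 'I_H) :
    profile n H :=
  [ffun j => if j == i then a else b j].

(* Utility of bidder i with value v if she bids a and the others bid as in x. *)
Definition utility (R : realType) (n H : nat) (i : 'I_n) (x : round n H)
    (v a : 'I_H) : R :=
  if winner (ties x) (set_bid (bids x) i a) == i
  then grid R v - max_others R i (bids x) else 0.

(* The mass function g_i of the highest value among the bidders other than i. *)
Definition max_value_pmf (R : realType) (n H : nat) (F : 'I_n -> fdist R 'I_H)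
    (i : 'I_n) (v : 'I_H) : R :=
  prob (indep_pmf F) (fun x => max_others R i x == grid R v).

(** Repeated play *)

(* The learners may use the whole past record; those that only use the
   information of their own bidder are a special case. *)
Definition strategies (R : realType) (n H : nat) : Type :=
  'I_n -> learner R (round n H) 'I_H 'I_H.

(* Bid of bidder i with value v after the rounds h. *)
Definition bid_pmf (R : realType) (n H T0 : nat) (L : strategies R n H)
    (h : seq (round n H)) (i : 'I_n) (v b : 'I_H) : R :=
  if (size h < T0)%N then H%:R^-1 else L i h v b.

(* Conditional law of the next round given the past rounds h. *)
Definition round_pmf (R : realType) (n H T0 : nat) (F : 'I_n -> fdist R 'I_H)
    (D : fdist R (winner_rule n H)) (L : strategies R n H)
    (h : seq (round n H)) (x : round n H) : R :=
  indep_pmf F (values x)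
  * indep_pmf (fun i => bid_pmf T0 L h i (values x i)) (bids x)
  * D (ties x).

(* Law of the first t rounds. *)
Definition play_pmf (R : realType) (n H T0 : nat) (F : 'I_n -> fdist R 'I_H)
    (D : fdist R (winner_rule n H)) (L : strategies R n H)
    (t : nat) (h : t.-tuple (round n H)) : R :=
  \prod_(s < t) round_pmf T0 F D L (take s h) (tnth h s).

(* Probability that round t satisfies E.  Rounds are numbered from 1, so the
   past of round t has length t - 1. *)
Definition round_prob (R : realType) (n H T0 : nat) (F : 'I_n -> fdist R 'I_H)
    (D : fdist R (winner_rule n H)) (L : strategies R n H)
    (t : nat) (E : pred (round n H)) : R :=
  \sum_(h : (t.-1).-tuple (round n H))
    play_pmf T0 F D L h * prob (round_pmf T0 F D L h) E.

Definition round_cond_prob (R : realType) (n H T0 : nat)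
    (F : 'I_n -> fdist R 'I_H) (D : fdist R (winner_rule n H))
    (L : strategies R n H) (t : nat) (E B : pred (round n H)) : R :=
  round_prob T0 F D L t (predI E B) / round_prob T0 F D L t B.

(* Main.v *)
Require Import Defs.
From HB Require Import structures.
From mathcomp Require Import all_boot all_order all_algebra.
From mathcomp Require Import all_classical all_reals all_analysis.
From mathcomp Require Import ring lra.

Set Implicit Arguments.
Unset Strict Implicit.
Unset Printing Implicit Defensive.

Import Order.TTheory GRing.Theory Num.Theory.
Import numFieldNormedType.Exports.

Local Open Scope classical_set_scope.
Local Open Scope ring_scope.

(* Truthful bidding is optimal round by round, and a bid [a] other than the value
   loses at least 1/H against it in the rounds, called costly, where the highest
   competing bid is [a] and the tie at [a] is resolved the wrong way.  Given the
   past, a round is costly with probability at least q = 7 tau / (8 n): while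
   exploring because the bids are uniform, and later because, as long as all the
   bidders have learned to be truthful, the competing bids are the competing
   values up to probability tau / 8, so that thickness applies.  Hence, up to the
   first time t >= T0 when some bidder may be untruthful, exp (- number of costly
   rounds) divided by (1 - q / 2)^t is a supermartingale.  For bidder i, value v
   and bid a, the probability that this time is t and that a caused it is thus at
   most exp (- 5 tau t / (16 n)); summing over i, v, a and t >= T0 is affordable
   because the exponent is larger than the one of the claim by a factor
   10 n H^2 / tau. *)

(** * Independent variables *)

Section IndependentVariables.
Variables (R : realType) (I A : finType) (mu : I -> A -> R).

(** Absorbing [g] into the factor of index [i] turns the sum into a product of sums, all equal to 1
    except the one at [i]. *)
Lemma sum_indep_pmf_coord (i : I) (g : A -> R) :
  (forall j, j != i -> \sum_a mu j a = 1) ->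
  \sum_x indep_pmf mu x * g (x i) = \sum_a mu i a * g a.
Proof.
move=> mu1.
pose f j a := mu j a * (if j == i then g a else 1).
transitivity (\sum_(x : {ffun I -> A}) \prod_j f j (x j)).
  apply: eq_bigr => x _; rewrite /f big_split /= -/(indep_pmf mu x).
  congr (_ * _); rewrite (bigD1 i) //= eqxx big1 ?mulr1 // => j /negPf -> //.
rewrite -bigA_distr_bigA (bigD1 i) //= [X in _ * X]big1 ?mulr1.
  by apply: eq_bigr => a _; rewrite /f eqxx.
move=> j ji; rewrite -(mu1 j ji); apply: eq_bigr => a _.
by rewrite /f (negPf ji) mulr1.
Qed.

Lemma sum_indep_pmf : (forall j, \sum_a mu j a = 1) -> \sum_x indep_pmf mu x = 1.
Proof.
by move=> mu1; rewrite /indep_pmf -bigA_distr_bigA big1.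
Qed.

Lemma indep_pmf_ge0 x : (forall j a, 0 <= mu j a) -> 0 <= indep_pmf mu x.
Proof. by move=> mu0; apply: prodr_ge0. Qed.

Definition agree_off (i : I) (x y : {ffun I -> A}) : bool :=
  [forall j, (j != i) ==> (x j == y j)].

(** Coordinate [i] is free, so its law sums out. This later bounds the law of a competing maximum
    from below by a single profile of competing bids. *)
Lemma prob_agree_off (i : I) (y : {ffun I -> A}) :
  \sum_a mu i a = 1 ->
  prob (indep_pmf mu) (fun x => agree_off i x y) = \prod_(j | j != i) mu j (y j).
Proof.
move=> mui; pose f j a := mu j a * ((j != i) ==> (a == y j))%:R.
transitivity (\sum_(x : {ffun I -> A}) \prod_j f j (x j)).
  rewrite /prob big_mkcond; apply: eq_bigr => x _; rewrite /f big_split /=.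
  rewrite -/(indep_pmf mu x); case: ifPn => [/forallP xy|].
    by rewrite [X in _ * X]big1 ?mulr1// => j _; rewrite xy.
  rewrite negb_forall => /existsP[j /negPf xyj].
  by rewrite [X in _ * X](bigD1 j) //= xyj mul0r mulr0.
rewrite -bigA_distr_bigA (bigD1 i) //= [X in X * _](_ : _ = 1) ?mul1r.
  apply: eq_bigr => j ji; rewrite (bigD1 (y j)) //= big1 /f ?ji ?eqxx ?mulr1 ?addr0 //.
  by move=> a /negPf ay; rewrite ay mulr0.
by rewrite -[RHS]mui; apply: eq_bigr => a _; rewrite /f eqxx mulr1.
Qed.

End IndependentVariables.

Lemma prod_ge_1Bcard (R : realType) (I : finType) (P : pred I) (f : I -> R) (c : R) :
  0 <= c -> (forall i, P i -> 0 <= f i) -> (forall i, P i -> 1 - c <= f i) ->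
  1 - #|P|%:R * c <= \prod_(i | P i) f i.
Proof.
move=> c0 f0 fc.
(* The factors are truncated at 1 to keep the partial products in [0, 1], as the induction needs;
   writing the cardinal as a sum lets both sides be unfolded together. *)
have : 1 - (\sum_(i | P i) 1%N)%:R * c <= \prod_(i | P i) Num.min 1 (f i).
  suff : (1 - (\sum_(i | P i) 1%N)%:R * c <= \prod_(i | P i) Num.min 1 (f i)) &&
     (0 <= \prod_(i | P i) Num.min 1 (f i) <= 1) by case/andP.
  elim/big_rec2: _ => [|i k p Pi /and3P[kp p0 p1]]; first by rewrite mul0r subr0 lexx ler01.
  have := f0 i Pi; have := fc i Pi; set m := Num.min _ _ => mc m0.
  have m1 : m <= 1 by rewrite ge_min lexx.
  have m0' : 0 <= m by rewrite le_min ler01.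
  have mc' : 1 - c <= m by rewrite le_min mc andbT; lra.
  rewrite natrD; apply/and3P; split; [nra|nra|nra].
rewrite sum1_card => /le_trans; apply.
apply: ler_prod => i Pi; rewrite ge_min lexx orbT andbT.
by rewrite le_min ler01 f0.
Qed.

(** * One auction *)

Section Auction.
Variables (R : realType) (n H : nat).
Implicit Types (i j : 'I_n) (b x : profile n H) (a v : 'I_H).

Lemma ler_grid a v : (grid R a <= grid R v) = (a <= v)%N.
Proof.
have H0 : 0 < H%:R^-1 :> R by rewrite invr_gt0 ltr0n; apply: leq_ltn_trans (ltn_ord a).
by rewrite ler_pM2r // ler_nat ltnS.
Qed.

Lemma ltr_grid a v : (grid R a < grid R v) = (a < v)%N.
Proof. by rewrite !ltNge ler_grid ltnNge. Qed.

Lemma grid_gap a v : (a < v)%N -> H%:R^-1 <= grid R v - grid R a.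
Proof.
move=> av; rewrite /grid -mulrBl -[leLHS]mul1r ler_wpM2r ?invr_ge0 //.
by rewrite lerBrDr -(natrD _ 1%N) ler_nat add1n !ltnS.
Qed.

Lemma grid_gt0 a : 0 < grid R a.
Proof. by rewrite divr_gt0 ?ltr0n //; apply: leq_ltn_trans (ltn_ord a). Qed.

Lemma grid_le_max_others i j b : j != i -> grid R (b j) <= max_others R i b.
Proof. by move=> ji; rewrite /max_others (le_bigmax_cond _ (fun j => grid R (b j))). Qed.

(** The default value 0 of the maximum lies strictly below the grid, so a maximum on the grid is
    attained by some competitor. *)
Lemma max_others_eq i b a : max_others R i b = grid R a ->
  (forall j, j != i -> (b j <= a)%N) /\ (exists2 j, j != i & b j = a).
Proof.
move=> mb; split=> [j ji|]; first by rewrite -ler_grid -mb grid_le_max_others.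
suff /exists_inP[j ji /eqP] : [exists (j | j != i), b j == a] by exists j.
have [//|nb] := boolP [exists (j | j != i), b j == a].
suff : max_others R i b < grid R a by rewrite mb ltxx.
apply: bigmax_lt => [|j ji]; first exact: grid_gt0.
have := grid_le_max_others b ji; rewrite mb ler_grid ltr_grid => ba'.
by rewrite ltn_neqAle ba' andbT; apply: contra nb => bja; apply/exists_inP; exists j.
Qed.

Lemma eq_max_others i b x : agree_off i b x -> max_others R i b = max_others R i x.
Proof. by move=> /forallP bx; apply: eq_bigr => j ji; have := bx j; rewrite ji => /eqP ->. Qed.

Lemma max_others_const i a : (1 < n)%N -> max_others R i [ffun => a] = grid R a.
Proof.
move=> n1; apply/eqP; rewrite eq_le; apply/andP; split.
  apply: bigmax_le => [|j _]; first exact/ltW/grid_gt0.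
  by rewrite ffunE.
have [j ji] : exists j, j != i.
  case: (eqVneq i (Ordinal n1)) => [->|i1]; last by exists (Ordinal n1); rewrite eq_sym.
  by exists (Ordinal (ltnW n1)).
by have := grid_le_max_others [ffun => a] ji; rewrite ffunE.
Qed.

Lemma winner_highest (w : winner_rule n H) b : winner w b \in highest b.
Proof. by have /forallP := valP w; apply. Qed.

Lemma winner_gt (w : winner_rule n H) i b a :
  max_others R i b < grid R a -> winner w (set_bid b i a) = i.
Proof.
move=> ma; have := winner_highest w (set_bid b i a).
rewrite inE => /forallP/(_ i); rewrite !ffunE eqxx.
case: eqP => // /eqP wi; rewrite leqNgt -ltr_grid => /negP[].
exact: le_lt_trans (grid_le_max_others b wi) ma.
Qed.

Lemma winner_lt (w : winner_rule n H) i b a :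
  grid R a < max_others R i b -> winner w (set_bid b i a) != i.
Proof.
move=> am; apply/negP => /eqP wi; have := winner_highest w (set_bid b i a).
rewrite wi inE => /forallP hi; move: am; rewrite ltNge => /negP; apply.
apply: bigmax_le => [|j ji]; first by rewrite ltW ?grid_gt0.
by have := hi j; rewrite !ffunE eqxx (negPf ji) ler_grid.
Qed.

(** Tie-breaking disappears: winning a tie at one's own value yields 0, just as losing it does. *)
Lemma utility_truthful i (x : round n H) v :
  utility R i x v v = Num.max 0 (grid R v - max_others R i (bids x)).
Proof.
rewrite /utility; have [lt|gt|->] := ltgtP (max_others R i (bids x)) (grid R v).
- by rewrite winner_gt // eqxx max_r // subr_ge0 ltW.
- by rewrite (negPf (winner_lt _ gt)) max_l // subr_le0 ltW.
- by rewrite subrr maxxx; case: ifP.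
Qed.

Lemma utility_le_truthful i (x : round n H) v a :
  utility R i x v a <= utility R i x v v.
Proof. by rewrite utility_truthful /utility le_max; case: ifP; rewrite lexx ?orbT. Qed.

(* Bidding [a] instead of the value [v] hurts: underbidding loses, or
   overbidding wins, a tie against a highest competing bid equal to [a]. *)
Definition costly i (x : round n H) v a : bool :=
  (max_others R i (bids x) == grid R a) &&
  ((winner (ties x) (set_bid (bids x) i a) == i) == (v < a)%N).

Lemma costly_gap i (x : round n H) v a : a != v -> costly i x v a ->
  utility R i x v a + H%:R^-1 <= utility R i x v v.
Proof.
move=> av /andP[/eqP ma /eqP w]; rewrite utility_truthful /utility w ma le_max.
have [va|] := ltnP v a; first by apply/orP; left; have := grid_gap va; lra.
rewrite leq_eqVlt (negPf (_ : val a != v)) //= => va; apply/orP; right.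
by have := grid_gap va; lra.
Qed.

Lemma cum_reward_gap i (h : seq (round n H)) v a : a != v ->
  cum_reward (utility R i) h v a + (count (fun y => costly i y v a) h)%:R / H%:R
  <= cum_reward (utility R i) h v v.
Proof.
move=> av; rewrite /cum_reward; elim: h => [|y h IH].
  by rewrite !big_nil /= mul0r addr0.
rewrite !big_cons /= natrD mulrDl; case: (boolP (costly i y v a)) => [cx|_].
  by have := costly_gap av cx; rewrite mul1r; lra.
by have := utility_le_truthful i y v a; rewrite mul0r; lra.
Qed.

(** Bidder [i] and at least one competitor share the tie, so the number m of highest bidders
    satisfies 2 <= m <= n. Winning has probability 1/m >= 1/n, losing 1 - 1/m >= 1/2 >= 1/n. *)
Lemma prob_tie_ge (D : fdist R (winner_rule n H)) i b v a :
  uniform_ties D -> max_others R i b = grid R a ->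
  n%:R^-1 <=
  \sum_w D w * ((winner w (set_bid b i a) == i) == (v < a)%N)%:R.
Proof.
move=> Du mb; set b' := set_bid b i a.
have [ba [k ki bk]] := max_others_eq mb.
have ih : i \in highest b'.
  rewrite inE; apply/forallP => j; rewrite !ffunE eqxx.
  by case: (eqVneq j i) => // ji; apply: ba.
have kh : k \in highest b'.
  rewrite inE; apply/forallP => j; rewrite !ffunE (negPf ki) bk.
  by case: (eqVneq j i) => // ji; apply: ba.
have c2 : (1 < #|highest b'|)%N.
  by rewrite (cardD1 i) ih (cardD1 k) !inE ki; move: kh; rewrite inE => ->.
have cn : (#|highest b'| <= n)%N by rewrite -[X in (_ <= X)%N](card_ord n) max_card.
have c0 : 0 < #|highest b'|%:R :> R by rewrite ltr0n; apply: ltn_trans c2.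
have n0 : 0 < n%:R :> R by apply: lt_le_trans c0 _; rewrite ler_nat.
have pw := Du b' i ih; rewrite /prob big_mkcond /= in pw.
have cV : n%:R^-1 <= #|highest b'|%:R^-1 :> R by rewrite lef_pV2 ?posrE // ler_nat.
case: (ltnP v a) => va.
  rewrite (_ : \sum_w _ = #|highest b'|%:R^-1) // -pw; apply: eq_bigr => w _.
  by case: (winner w b' == i); rewrite ?mulr1 ?mulr0.
rewrite (_ : \sum_w _ = 1 - #|highest b'|%:R^-1).
  have h2 : #|highest b'|%:R^-1 <= 2^-1 :> R by rewrite lef_pV2 ?posrE // (ler_nat R 2).
  by lra.
rewrite -pw -[X in _ = X - _](Defs.pmf_sum1 D) -sumrB; apply: eq_bigr => w _.
by case: (winner w b' == i); rewrite ?mulr1 ?mulr0 ?subrr ?subr0.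
Qed.

End Auction.

(** * Repeated play *)

Lemma sum_rcons (R : realType) (A : finType) t (f : seq A -> R) :
  \sum_(h : t.+1.-tuple A) f h = \sum_(h : t.-tuple A) \sum_a f (rcons h a).
Proof.
pose g (p : t.-tuple A * A) : t.+1.-tuple A := [tuple of rcons p.1 p.2].
rewrite pair_bigA /= (reindex g) //=; apply: onW_bij; apply: inj_card_bij.
  move=> [h a] [k b] /(congr1 val) /= /rcons_inj [hk ->].
  by congr (_, _); apply: val_inj.
by rewrite card_prod !card_tuple expnSr.
Qed.

Section Play.
Variables (R : realType) (n H T0 : nat) (F : 'I_n -> fdist R 'I_H).
Variables (D : fdist R (winner_rule n H)) (L : strategies R n H).
Hypothesis H_gt0 : (0 < H)%N.
Implicit Types (h : seq (round n H)) (x : round n H) (i j : 'I_n).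

Let rpmf := round_pmf T0 F D L.

Lemma bid_pmf_ge0 h i v b : 0 <= bid_pmf T0 L h i v b.
Proof.
by rewrite /bid_pmf; case: ifP => _; [rewrite invr_ge0 ler0n | exact: Defs.pmf_ge0].
Qed.

Lemma bid_pmf_sum1 h i v : \sum_b bid_pmf T0 L h i v b = 1.
Proof.
rewrite /bid_pmf; case: (ltnP (size h) T0) => _; last exact: Defs.pmf_sum1.
by rewrite sumr_const card_ord -[LHS]mulr_natr mulVf // pnatr_eq0 -lt0n.
Qed.

Lemma round_pmf_ge0 h x : 0 <= rpmf h x.
Proof.
rewrite /rpmf /round_pmf !mulr_ge0 ?Defs.pmf_ge0 //; apply: indep_pmf_ge0 => *.
  exact: Defs.pmf_ge0.
exact: bid_pmf_ge0.
Qed.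

Lemma play_pmf_ge0 t (h : t.-tuple (round n H)) : 0 <= play_pmf T0 F D L h.
Proof. by apply: prodr_ge0 => s _; apply: round_pmf_ge0. Qed.

Lemma round_sumE h (f : round n H -> R) :
  \sum_x rpmf h x * f x =
  \sum_vals indep_pmf F vals *
    \sum_bids indep_pmf (fun i => bid_pmf T0 L h i (vals i)) bids *
      \sum_w D w * f (vals, bids, w).
Proof.
under [RHS]eq_bigr => vals _ do rewrite big_distrr /=.
rewrite pair_bigA /=.
under [RHS]eq_bigr => p _ do rewrite !big_distrr /=.
rewrite pair_bigA /=; apply: eq_bigr => -[[vals bids] w] _ /=.
by rewrite /rpmf /round_pmf /values /Defs.bids /= !mulrA.
Qed.

Lemma round_sum_bid h (f : profile n H -> profile n H -> R) :
  \sum_x rpmf h x * f (values x) (bids x) =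
  \sum_vals indep_pmf F vals *
    \sum_bids indep_pmf (fun i => bid_pmf T0 L h i (vals i)) bids * f vals bids.
Proof.
rewrite round_sumE; apply: eq_bigr => vals _; congr (_ * _); apply: eq_bigr => y _.
by rewrite /values /bids /= -big_distrl /= Defs.pmf_sum1 mul1r.
Qed.

Lemma round_sum_own h i (f : 'I_H -> 'I_H -> R) :
  \sum_x rpmf h x * f (values x i) (bids x i) =
  \sum_v F i v * \sum_b bid_pmf T0 L h i v b * f v b.
Proof.
rewrite (round_sum_bid h (fun vals y => f (vals i) (y i))).
under eq_bigr => vals _.
  rewrite (sum_indep_pmf_coord (i := i) (f (vals i))); last first.
    by move=> j _; apply: bid_pmf_sum1.
  over.
rewrite (sum_indep_pmf_coord (i := i) (fun v => \sum_b bid_pmf T0 L h i v b * f v b)) //.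
by move=> j _; apply: Defs.pmf_sum1.
Qed.

Lemma round_sum1 h : \sum_x rpmf h x = 1.
Proof.
under eq_bigr => x _ do rewrite -[rpmf h x]mulr1.
rewrite (round_sum_bid h (fun _ _ => 1)).
under eq_bigr => vals _.
  under eq_bigr => y _ do rewrite mulr1.
  rewrite sum_indep_pmf => [|j]; last exact: bid_pmf_sum1.
  rewrite mulr1; over.
by apply: sum_indep_pmf => j; apply: Defs.pmf_sum1.
Qed.

(** [f] is defined on lists rather than tuples, so that one function can be followed along histories
    of all lengths. *)
Definition expect t (f : seq (round n H) -> R) : R :=
  \sum_(h : t.-tuple (round n H)) play_pmf T0 F D L h * f h.

Lemma expectS t f :
  expect t.+1 f = expect t (fun h => \sum_x rpmf h x * f (rcons h x)).
Proof.
(* The law of play restated on lists; [drop s h] exposes round [s] without a default record, and the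
   value 0 is never reached for [s < size h]. *)
pose pl h := \prod_(s < size h) (if drop s h is x :: _ then rpmf (take s h) x else 0).
have plE s (h : s.-tuple (round n H)) : play_pmf T0 F D L h = pl h.
  rewrite /pl /play_pmf size_tuple; apply: eq_bigr => k _.
  have x0 := tnth h k.
  by rewrite (drop_nth x0) ?size_tuple // (tnth_nth x0).
rewrite /expect; under eq_bigr => h _ do rewrite plE.
rewrite (sum_rcons _ (fun h => pl h * f h)); apply: eq_bigr => h _.
rewrite big_distrr /=; apply: eq_bigr => x _; rewrite plE mulrA; congr (_ * _).
rewrite /pl size_rcons big_ord_recr /= drop_rcons // drop_size /=.
rewrite -cats1 take_size_cat //; congr (_ * _); apply: eq_bigr => k _.
by rewrite takel_cat 1?ltnW // drop_cat ltn_ord (drop_nth x).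
Qed.

Lemma expect0 f : expect 0 f = f [::].
Proof.
rewrite /expect (bigD1 [tuple]) //= big1 ?addr0; last by move=> h /negP[]; rewrite [h]tuple0.
by rewrite /play_pmf big_ord0 mul1r.
Qed.

Lemma expect_le t f g :
  (forall h, size h = t -> f h <= g h) -> expect t f <= expect t g.
Proof.
move=> fg; apply: ler_sum => h _; apply: ler_wpM2l; first exact: play_pmf_ge0.
by apply: fg; rewrite size_tuple.
Qed.

Lemma expect_eq t f g :
  (forall h, size h = t -> f h = g h) -> expect t f = expect t g.
Proof. by move=> fg; apply: eq_bigr => h _; rewrite fg // size_tuple. Qed.

Lemma expectZ t c f : expect t (fun h => c * f h) = c * expect t f.
Proof. by rewrite /expect big_distrr; apply: eq_bigr => h _; rewrite mulrCA. Qed.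

Lemma expectD t f g : expect t (fun h => f h + g h) = expect t f + expect t g.
Proof. by rewrite /expect -big_split; apply: eq_bigr => h _; rewrite mulrDr. Qed.

Lemma expect_sum t (J : finType) (f : J -> seq (round n H) -> R) :
  expect t (fun h => \sum_k f k h) = \sum_k expect t (f k).
Proof.
rewrite /expect exchange_big; apply: eq_bigr => h _; exact: big_distrr.
Qed.

Lemma expect_cst t c : expect t (fun=> c) = c.
Proof.
elim: t => [|t IH]; first by rewrite expect0.
rewrite expectS -[RHS]IH; apply: expect_eq => h _.
by rewrite -big_distrl /= round_sum1 mul1r.
Qed.

Lemma round_prob_value t i v :
  round_prob T0 F D L t (fun x => values x i == v) = F i v.
Proof.
rewrite -(expect_cst t.-1 (F i v)); apply: eq_bigr => h _; congr (_ * _).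
rewrite /prob big_mkcond.
transitivity (\sum_x rpmf h x * (values x i == v)%:R).
  by apply: eq_bigr => x _; case: eqP; rewrite ?mulr1 ?mulr0.
rewrite (round_sum_own h i (fun u _ => (u == v)%:R)) (bigD1 v) //=.
rewrite eqxx -big_distrl /= bid_pmf_sum1 !mulr1 big1 ?addr0 // => u /negPf ->.
by rewrite big1 ?mulr0 // => b _; rewrite mulr0.
Qed.

Lemma round_prob_truthful t i v :
  round_prob T0 F D L t
    (predI (fun x => bids x i == values x i) (fun x => values x i == v)) =
  F i v * expect t.-1 (fun h => bid_pmf T0 L h i v v).
Proof.
rewrite -expectZ; apply: eq_bigr => h _; congr (_ * _).
rewrite /prob big_mkcond.
transitivity (\sum_x rpmf h x * ((bids x i == values x i) && (values x i == v))%:R).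
  by apply: eq_bigr => x _ /=; case: andP => _; rewrite ?mulr1 ?mulr0.
rewrite (round_sum_own h i (fun u b => ((b == u) && (u == v))%:R)) (bigD1 v) //=.
rewrite [X in _ + X]big1 ?addr0 => [|u /negPf uv]; last first.
  by rewrite big1 ?mulr0 // => b _; rewrite uv andbF mulr0.
congr (_ * _); rewrite (bigD1 v) //= !eqxx mulr1 big1 ?addr0 // => b /negPf ->.
by rewrite mulr0.
Qed.

(** The current value is independent of the past, so [F i v] factors out of numerator and
    denominator. *)
Lemma round_cond_prob_truthful t i v : 0 < F i v ->
  round_cond_prob T0 F D L t
    (fun x => bids x i == values x i) (fun x => values x i == v) =
  expect t.-1 (fun h => bid_pmf T0 L h i v v).
Proof.
move=> Fv; rewrite /round_cond_prob round_prob_truthful round_prob_value.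
by rewrite mulrAC divff ?mul1r // gt_eqF.
Qed.

End Play.

(** * Learning to be truthful *)

Section Learning.
Variables (R : realType) (n H T0 : nat).
Hypotheses (n_ge2 : (2 <= n)%N) (H_gt0 : (0 < H)%N) (T0_gt0 : (0 < T0)%N).
Variables (F : 'I_n -> fdist R 'I_H) (D : fdist R (winner_rule n H)).
Hypothesis D_uniform : uniform_ties D.
Variables (gamma : nat -> R) (L : strategies R n H).
Hypothesis L_mean_based : forall i : 'I_n, mean_based gamma (utility R i) (L i).
Variable tau : R.
Hypotheses (tau_gt0 : 0 < tau) (tau_le : tau <= (H%:R ^+ (n - 1))^-1).
Hypothesis thick : forall (i : 'I_n) (v : 'I_H), tau <= max_value_pmf F i v.
Hypothesis gamma_small :
  forall t : nat, (T0 <= t)%N -> gamma t <= tau / (8 * n%:R * H%:R).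
Implicit Types (h : seq (round n H)) (x : round n H) (i j : 'I_n) (v a : 'I_H).

Let rpmf := round_pmf T0 F D L.
Let E := expect T0 F D L.

Let n0 : 0 < n%:R :> R. Proof. by rewrite ltr0n ltnW. Qed.
Let H0 : 0 < H%:R :> R. Proof. by rewrite ltr0n. Qed.

(** With a negative rate, the mean-based condition applied to an action compared with itself would
    give that action a negative probability. *)
Lemma mean_based_rate_ge0 t : (0 < t)%N -> 0 <= gamma t.
Proof.
move=> t0; rewrite leNgt; apply/negP => gt.
pose i := Ordinal (ltnW n_ge2); pose v := Ordinal H_gt0.
(* Some tie-breaking outcome is needed to build a history of length [t]; one exists because [D] has
   total mass 1. *)
have [w _] : exists w, D w != 0.
  apply/existsP; rewrite -[[exists _, _]]negbK negb_exists; apply/negP => /forallP D0.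
  have := Defs.pmf_sum1 D; rewrite big1 => [/esym/eqP|w _]; first by rewrite oner_eq0.
  by have := D0 w; rewrite negbK => /eqP.
pose h := nseq t ([ffun => v], [ffun => v], w) : seq (round n H).
have := @L_mean_based i h v v v; rewrite size_nseq -{1}[cum_reward _ _ _ _]subr0.
rewrite ltrD2l ltrN2 nmulr_rlt0 // ltr0n t0 => /(_ isT).
by rewrite leNgt (lt_le_trans gt) // Defs.pmf_ge0.
Qed.

Definition costs i v a h : nat := count (fun x => costly R i x v a) h.

(* Each costly round is a loss of at least 1/H, so by [gamma_small] this many
   of them separate the truthful bid from [a] by more than [gamma t * t]. *)
Definition learned h : bool :=
  (size h < T0)%N ||
  [forall i, forall v, forall a,
     (a != v) ==> (tau * (size h)%:R / (8 * n%:R) < (costs i v a h)%:R)].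

Lemma learned_le h i v a : (T0 <= size h)%N -> learned h -> a != v ->
  L i h v a <= gamma (size h).
Proof.
rewrite /learned ltnNge => T0h; rewrite T0h /=.
move=> /forallP/(_ i)/forallP/(_ v)/forallP/(_ a)/implyP lh av; apply: (L_mean_based (b := v)).
have := cum_reward_gap R i h av; have := lh av; rewrite /costs; set N := count _ _ => hN cg.
suff : gamma (size h) * (size h)%:R < N%:R / H%:R by lra.
rewrite ltr_pdivlMr //; apply: le_lt_trans hN.
have s0 : 0 <= (size h)%:R :> R by rewrite ler0n.
have := gamma_small T0h; set s := (size h)%:R => gs.
rewrite (_ : tau * s / _ = tau / (8 * n%:R * H%:R) * s * H%:R); last by field; rewrite !gt_eqF.
by rewrite ler_wpM2r ?ler_wpM2r // ltW.
Qed.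

(** Each of the [H - 1] untruthful bids has probability at most [gamma (size h)]. Keeping [H - 1]
    instead of [H] leaves room for the final shift of index. *)
Lemma learned_truthful h i v : (T0 <= size h)%N -> learned h ->
  1 - (H%:R - 1) * gamma (size h) <= L i h v v.
Proof.
move=> T0h lh; have := Defs.pmf_sum1 (L i h v); rewrite (bigD1 v) //= => LE.
have : \sum_(a | a != v) L i h v a <= \sum_(a | a != v) gamma (size h).
  by apply: ler_sum => a av; apply: learned_le.
rewrite sumr_const (_ : #|_| = H.-1); last first.
  by have := cardC1 v; rewrite card_ord.
rewrite -[gamma _ *+ _]mulr_natl -subn1 natrB //; lra.
Qed.

(** While exploring, all competitors bid [a] with probability [H ^ -(n - 1)], at least [tau]. Later,
    the competing values have maximum [a] with probability at least [tau], and all competitors are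
    then truthful with probability at least 7/8. *)
Lemma competing_max_prob h i a : learned h ->
  7 / 8 * tau <=
  \sum_vals indep_pmf F vals *
    \sum_y indep_pmf (fun j => bid_pmf T0 L h j (vals j)) y *
      (max_others R i y == grid R a)%:R.
Proof.
move=> lh; set mu := fun vals j => bid_pmf T0 L h j (vals j).
have agree vals z : max_others R i z = grid R a ->
    \prod_(j | j != i) mu vals j (z j) <=
    \sum_y indep_pmf (mu vals) y * (max_others R i y == grid R a)%:R.
  move=> mz; rewrite -prob_agree_off; last exact: bid_pmf_sum1.
  rewrite /prob big_mkcond; apply: ler_sum => y _; case: ifP => [yz|_].
    by rewrite (eq_max_others R yz) mz eqxx mulr1.
  by rewrite mulr_ge0 // indep_pmf_ge0 // => j b; apply: bid_pmf_ge0.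
have F0 vals : 0 <= indep_pmf F vals by apply: indep_pmf_ge0 => *; apply: Defs.pmf_ge0.
have F1 : \sum_vals indep_pmf F vals = 1 by apply: sum_indep_pmf => j; apply: Defs.pmf_sum1.
have card_i : #|[pred j | j != i]| = (n - 1)%N by have := cardC1 i; rewrite card_ord subn1.
have [hT0|T0h] := ltnP (size h) T0.
  apply: (@le_trans _ _ tau); first by move: tau_gt0; lra.
  rewrite -[leLHS]mul1r -[X in X * _ <= _]F1 big_distrl /=; apply: ler_sum => vals _.
  rewrite ler_wpM2l //.
  apply: (le_trans _ (agree vals [ffun => a] (max_others_const R i a n_ge2))).
  rewrite /mu /bid_pmf hT0 prodr_const exprVn card_i.
  exact: tau_le.
apply: (@le_trans _ _ (max_value_pmf F i a * (7 / 8))).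
  by have := thick i a; move: tau_gt0; lra.
rewrite /max_value_pmf /prob big_distrl big_mkcond /=; apply: ler_sum => vals _.
case: ifP => [/eqP mv|_]; last first.
  rewrite mulr_ge0 // sumr_ge0 // => y _; rewrite mulr_ge0 //.
  by apply: indep_pmf_ge0 => *; apply: bid_pmf_ge0.
rewrite ler_wpM2l //; apply: (le_trans _ (agree vals vals mv)).
have g0 : 0 <= gamma (size h) by apply: mean_based_rate_ge0; apply: leq_trans T0h.
have H1 : 1 <= H%:R :> R by rewrite ler1n.
have n1 : 1 <= n%:R :> R by rewrite ler1n ltnW.
(* Union bound over the competitors: the loss is at most [n * H * gamma], hence at most
   [tau / 8 <= 1 / 8]. *)
apply: (@le_trans _ _ (1 - #|[pred j | j != i]|%:R * ((H%:R - 1) * gamma (size h)))).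
  rewrite card_i natrB 1?ltnW //.
  have t1 : tau <= 1 by apply: le_trans tau_le _; rewrite invf_le1 ?exprn_gt0 // exprn_ege1.
  have := gamma_small T0h; rewrite ler_pdivlMr ?mulr_gt0 //.
  set g := gamma _ in g0 *; move=> gs.
  have : (n%:R - 1) * ((H%:R - 1) * g) <= n%:R * (H%:R * g).
    apply: ler_pM; rewrite ?mulr_ge0 ?subr_ge0 //; first by lra.
    by apply: ler_wpM2r => //; lra.
  by lra.
apply: prod_ge_1Bcard => [|j _|j _].
- by rewrite mulr_ge0 // subr_ge0.
- exact: bid_pmf_ge0.
- by rewrite /mu /bid_pmf ltnNge T0h /=; apply: learned_truthful.
Qed.

Let q : R := 7 / 8 * tau / n%:R.

Lemma costly_prob h i v a : learned h ->
  q <= \sum_x rpmf h x * (costly R i x v a)%:R.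
Proof.
move=> lh; rewrite /rpmf round_sumE.
apply: (le_trans (ler_wpM2r _ (competing_max_prob i a lh))); first by rewrite invr_ge0 ltW.
rewrite big_distrl; apply: ler_sum => vals _ /=; rewrite -mulrA.
apply: ler_wpM2l; first by apply: indep_pmf_ge0 => *; apply: Defs.pmf_ge0.
rewrite big_distrl; apply: ler_sum => y _ /=; rewrite -mulrA.
apply: ler_wpM2l; first by apply: indep_pmf_ge0 => *; apply: bid_pmf_ge0.
rewrite /costly /bids /ties /=; case: eqP => [mb|_].
  by rewrite mul1r; apply: prob_tie_ge.
by rewrite mul0r sumr_ge0 // => w _; rewrite mulr0.
Qed.

(** Only proper prefixes are tested, so safety after a round is already decided before that round,
    as a stopping time requires. *)
Definition safe h : bool := all (fun s => learned (take s h)) (iota 0 (size h)).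

Lemma safe_rcons h x : safe (rcons h x) = safe h && learned h.
Proof.
rewrite /safe size_rcons -addn1 iotaD all_cat /= andbT -cats1 take_size_cat //.
congr (_ && _); apply: eq_in_all => s; rewrite mem_iota => /andP[_ sh].
by rewrite takel_cat // ltnW.
Qed.

Lemma weight_rate_ge0 : 0 <= 1 - q / 2.
Proof.
have n2 : 2 <= n%:R :> R by rewrite (ler_nat R 2).
have t1 : tau <= 1.
  by apply: le_trans tau_le _; rewrite invf_le1 ?exprn_gt0 // exprn_ege1 // ler1n.
suff : q <= 1 by lra.
by rewrite /q ler_pdivrMr // mul1r; lra.
Qed.

(* Conditionally on a learned past, the weight is multiplied on average by at
   most 1 - q (1 - 1/e) <= 1 - q / 2. *)
Lemma expect_safe_weight t i v a :
  E t (fun h => (safe h)%:R * expR (- (costs i v a h)%:R)) <= (1 - q / 2) ^+ t.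
Proof.
elim: t => [|t IH]; first by rewrite /E expect0 expr0 /costs /= mul1r oppr0 expR0.
have q1 := weight_rate_ge0.
rewrite exprS; apply: (le_trans _ (ler_wpM2l q1 IH)).
rewrite /E expectS -expectZ; apply: expect_le => h _.
under eq_bigr => x _ do rewrite safe_rcons.
case: (boolP (safe h)) => _ /=; last first.
  by rewrite big1 ?mul0r ?mulr0 // => x _; rewrite mul0r mulr0.
case: (boolP (learned h)) => [lh|_]; last first.
  by rewrite big1 => [|x _]; rewrite ?mul0r ?mulr0 // mul1r mulr_ge0 // expR_ge0.
have e2 : expR (-1) <= 2^-1 :> R.
  by rewrite expRN lef_pV2 ?posrE ?expR_gt0 //; have := expR_ge1Dx (1 : R); lra.
rewrite mul1r; set w := expR _.
have -> : (1 - q / 2) * w = w * (1 - q / 2) by rewrite mulrC.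
(* For c in {0, 1}, exp (- c) <= 1 - c / 2, which makes the bound linear in the probability of a
   costly round. *)
apply: (@le_trans _ _ (\sum_x w * (rpmf h x - 2^-1 * (rpmf h x * (costly R i x v a)%:R)))).
  apply: ler_sum => x _; rewrite mul1r /costs -cats1 count_cat /= addn0 natrD opprD expRD -/w.
  have := round_pmf_ge0 T0 F D L h x; rewrite -/rpmf => r0.
  have w0 : 0 <= w by apply: expR_ge0.
  rewrite mulrCA ler_wpM2l //; case: (costly _ _ _ _ _) => /=; last first.
    by rewrite oppr0 expR0 mulr1 mulr0 mulr0 subr0.
  by rewrite mulr1; have := ler_wpM2l r0 e2; lra.
rewrite -big_distrr /= ler_wpM2l ?expR_ge0 // sumrB -big_distrr /= round_sum1 //.
have := costly_prob i v a lh; lra.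
Qed.

(** The Markov factor exp (tau / (8 n)) per round times the decay exp (- q / 2), since 1/8 - 7/16 =
    - 5/16. *)
Let r : R := expR (- (5 / 16 * tau / n%:R)).

(** Decomposition by the first unlearned time [s]: some triple of bidder, value and bid then has at
    most [tau * s / (8 * n)] costly rounds, which Markov's inequality for [exp (- costs)] makes
    unlikely. *)
Lemma prob_unlearned t :
  E t (fun h => (~~ (safe h && learned h))%:R) <=
  \sum_(s < t.+1 | (T0 <= s)%N) (n * H * H)%:R * r ^+ s.
Proof.
pose f (p : 'I_n * 'I_H * 'I_H) h := (safe h)%:R * expR (- (costs p.1.1 p.1.2 p.2 h)%:R) : R.
(* The Markov factor is 0 before [T0], where every history counts as learned. *)
pose c s : R := if (T0 <= s)%N then expR (tau / (8 * n%:R)) ^+ s else 0.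
have c0 s : 0 <= c s by rewrite /c; case: ifP => // _; rewrite exprn_ge0 ?expR_ge0.
have split_le s : E s (fun h => (~~ (safe h && learned h))%:R) <=
    E s (fun h => (~~ safe h)%:R) + c s * \sum_p E s (f p).
  rewrite -expect_sum -expectZ -expectD; apply: expect_le => h hs.
  have f0 p : 0 <= f p h by rewrite mulr_ge0 ?expR_ge0.
  case: (boolP (safe h)) => [sh|_] /=; last first.
    by rewrite lerDl mulr_ge0 ?sumr_ge0.
  rewrite add0r; case: (boolP (learned h)) => [_|]; first by rewrite mulr_ge0 ?sumr_ge0.
  rewrite negb_or -leqNgt /c hs => /andP[-> nl].
  have [i [v [a nlt]]] : exists i v a, ~~ (tau * s%:R / (8 * n%:R) < (costs i v a h)%:R).
    move: nl; rewrite negb_forall => /existsP[i]; rewrite negb_forall => /existsP[v].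
    rewrite negb_forall => /existsP[a]; rewrite negb_imply => /andP[_ nl].
    by exists i, v, a.
  rewrite (bigD1 (i, v, a)) //= mulrDr -[leLHS]addr0 lerD //; last first.
    by rewrite mulr_ge0 ?sumr_ge0 // exprn_ge0 ?expR_ge0.
  rewrite /f sh mul1r -expRM_natl -expRD -[leLHS]expR0 ler_expR /=.
  rewrite subr_ge0 leNgt; apply: contra nlt; rewrite [s%:R * _]mulrC.
  by rewrite mulrAC.
have tail_le s : c s * \sum_p E s (f p) <=
    if (T0 <= s)%N then (n * H * H)%:R * r ^+ s else 0.
  rewrite /c; case: ifP => _; last by rewrite mul0r.
  have -> : r = expR (tau / (8 * n%:R)) * expR (- (q / 2)).
    by rewrite -expRD; congr expR; rewrite /q; field; rewrite gt_eqF.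
  rewrite exprMn mulrCA ler_wpM2l ?exprn_ge0 ?expR_ge0 //.
  have -> : (n * H * H)%N = #|{: 'I_n * 'I_H * 'I_H}| by rewrite !card_prod !card_ord.
  rewrite mulr_natl -sumr_const; apply: ler_sum => p _.
  apply: (le_trans (expect_safe_weight s p.1.1 p.1.2 p.2)).
  apply: lerXn2r; rewrite ?nnegrE ?expR_ge0 //; last exact: expR_ge1Dx.
  exact: weight_rate_ge0.
elim: t => [|t IH].
  rewrite big_mkcond big_ord_recr /= big_ord0 add0r.
  by apply: (le_trans (split_le 0%N)); rewrite {1}/E expect0 mulr0n add0r; apply: tail_le.
rewrite big_mkcond big_ord_recr -big_mkcond /=.
apply: (le_trans (split_le t.+1)); apply: lerD; last exact: tail_le.
apply: le_trans IH; rewrite /E expectS; apply: expect_le => h _.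
under eq_bigr => x _ do rewrite safe_rcons.
by rewrite -big_distrl /= round_sum1 // mul1r.
Qed.

Lemma truthful_prob_ge t i v : (T0 <= t)%N ->
  1 - (H%:R - 1) * gamma t
    - \sum_(s < t.+1 | (T0 <= s)%N) (n * H * H)%:R * r ^+ s
  <= E t (fun h => bid_pmf T0 L h i v v).
Proof.
move=> T0t; have g0 : 0 <= gamma t by apply: mean_based_rate_ge0; apply: leq_trans T0t.
have H1 : 0 <= (H%:R - 1) * gamma t by rewrite mulr_ge0 // subr_ge0 ler1n.
apply: (@le_trans _ _ (E t (fun h => 1 - (H%:R - 1) * gamma t +
    - 1 * (~~ (safe h && learned h))%:R))).
  rewrite /E expectD expectZ expect_cst // lerD2l mulN1r lerN2; exact: prob_unlearned.
(* On the failure event the lower bound is at most 0, so nonnegativity of the bid probability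
   suffices. *)
apply: expect_le => h hs; case: (boolP (safe h && learned h)) => [/andP[_ lh]|_].
  rewrite mulr0 addr0 /bid_pmf hs ltnNge T0t /= -hs.
  by apply: learned_truthful => //; rewrite hs.
by have := bid_pmf_ge0 T0 L h i v v; move: H1; rewrite mulr1; lra.
Qed.

End Learning.

(** * Numerical bounds *)

Lemma geometric_tail_le (R : realType) (x : R) (m t : nat) : 0 <= x < 1 ->
  \sum_(s < t | (m <= s)%N) x ^+ s <= x ^+ m / (1 - x).
Proof.
move=> /andP[x0 x1]; have x1' : 0 < 1 - x by lra.
(* The sum telescopes; [maxn m t] also covers the empty sum when [t <= m]. *)
rewrite ler_pdivlMr //; suff : (\sum_(s < t | (m <= s)%N) x ^+ s) * (1 - x) =
    x ^+ m - x ^+ maxn m t.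
  by move=> ->; rewrite gerBl exprn_ge0.
elim: t => [|t IH]; first by rewrite big_ord0 mul0r maxn0 subrr.
rewrite big_mkcond big_ord_recr -big_mkcond /= mulrDl IH.
case: leqP => mt.
  rewrite (maxn_idPr (leqW mt)) exprS; ring.
by rewrite (maxn_idPl mt) mul0r addr0.
Qed.

(* With [y = n H^2 / tau], the left-hand side is at most
   [4 y^2 expR (- 10 y X)], and [X >= 1 / 2]. *)
Lemma failure_bound (R : realType) (n H T0 : nat) (tau : R) (t : nat) :
  (2 <= n)%N -> (0 < H)%N -> 0 < tau <= 1 ->
  let X := tau ^+ 2 * T0%:R / (32 * n%:R ^+ 2 * H%:R ^+ 2) in
  expR (- X) <= 1 / 2 ->
  \sum_(s < t | (T0 <= s)%N) (n * H * H)%:R * expR (- (5 / 16 * tau / n%:R)) ^+ s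
  <= 4 * expR (- X).
Proof.
move=> n2 H0 /andP[t0 t1] X X2.
have n2' : 2 <= n%:R :> R by rewrite (ler_nat R 2).
have n0 : 0 < n%:R :> R by lra.
have H1 : 1 <= H%:R :> R by rewrite ler1n.
have H0' : 0 < H%:R :> R by lra.
have Xh : 1 / 2 <= X by have := expR_ge1Dx (- X); lra.
rewrite -big_distrr /=; set x := 5 / 16 * tau / n%:R.
have x0 : 0 < x by rewrite /x !mulr_gt0 ?invr_gt0.
have ex : expR (- x) <= (1 + x)^-1.
  by rewrite expRN lef_pV2 ?posrE ?expR_gt0 ?expR_ge1Dx //; lra.
have r1 : (1 + x)^-1 < 1 by rewrite invf_lt1; lra.
(* The constant of the geometric tail, controlled through exp (- x) <= 1 / (1 + x). *)
have ir : (1 - expR (- x))^-1 <= (1 + x) / x.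
  have d0 : 0 < x / (1 + x) by rewrite divr_gt0 //; lra.
  have d1 : 0 < 1 - expR (- x) by lra.
  rewrite -[leRHS]invf_div lef_pV2 ?posrE //.
  suff : x / (1 + x) = 1 - (1 + x)^-1 by lra.
  by field; rewrite gt_eqF //; lra.
apply: (le_trans (ler_wpM2l _ (geometric_tail_le _ _ _))) => //.
  by rewrite expR_ge0; lra.
rewrite -expRM_natl.
pose y := n%:R * H%:R ^+ 2 / tau.
have xT : T0%:R * - x = - (10 * y * X).
  by rewrite /x /y /X; field; rewrite !gt_eqF.
have y0 : 0 < y by rewrite /y divr_gt0 // mulr_gt0 // exprn_gt0.
have HH : 1 <= H%:R ^+ 2 :> R by rewrite exprn_ege1.
have yn : n%:R <= y.
  rewrite /y ler_pdivlMr //; nra.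
rewrite xT; set e := expR (- (10 * y * X)).
have e0 : 0 < e by apply: expR_gt0.
have Kx : (n * H * H)%:R * ((1 + x) / x) <= 4 * y ^+ 2.
  have -> : (n * H * H)%:R = n%:R * H%:R ^+ 2 :> R by rewrite !natrM; ring.
  have -> : n%:R * H%:R ^+ 2 * ((1 + x) / x) = y * (tau + 16 / 5 * n%:R).
    by rewrite /x /y; field; rewrite !gt_eqF.
  nra.
apply: (@le_trans _ _ (4 * y ^+ 2 * e)).
  set K := (n * H * H)%:R in Kx *; have K0 : 0 <= K by rewrite ler0n.
  rewrite mulrA; apply: (le_trans (ler_wpM2l (mulr_ge0 K0 (ltW e0)) ir)).
  by rewrite mulrAC; apply: ler_wpM2r (ltW e0) _ _ Kx.
(* The polynomial prefactor costs only [2 * y], which is at most [4 * y * X]; the remaining exponent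
   [6 * y * X] still exceeds [X]. *)
have ey : y ^+ 2 <= expR (2 * y).
  rewrite (_ : 2 * y = y + y); last by ring.
  by rewrite expRD expr2 ler_pM // ?ltW //; have := expR_ge1Dx y; lra.
rewrite -mulrA ler_wpM2l //; apply: (le_trans (ler_wpM2r (ltW e0) ey)).
rewrite /e -expRD ler_expR; nra.
Qed.

Theorem theorem3p1 (R : realType) (n H T0 : nat)
  (n_ge2 : (2 <= n)%N) (H_gt0 : (0 < H)%N)
  (F : 'I_n -> fdist R 'I_H)
  (D : fdist R (winner_rule n H)) (D_uniform : uniform_ties D)
  (gamma : nat -> R)
  (gamma_incr : forall s t : nat, (0 < s <= t)%N ->
     gamma s * s%:R <= gamma t * t%:R)
  (gamma_cvg0 : gamma @ \oo --> (0 : R))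
  (L : strategies R n H)
  (L_mean_based : forall i : 'I_n, mean_based gamma (utility R i) (L i))
  (tau : R) (tau_gt0 : 0 < tau) (tau_le : tau <= (H%:R ^+ (n - 1))^-1)
  (thick : forall (i : 'I_n) (v : 'I_H), tau <= max_value_pmf F i v)
  (T0_large : expR (- (tau ^+ 2 * T0%:R / (32 * n%:R ^+ 2 * H%:R ^+ 2)))
              <= 1 / 2)
  (gamma_small : forall t : nat, (T0 <= t)%N ->
     gamma t <= tau / (8 * n%:R * H%:R)) :
  let p (t : nat) : R :=
    1 - H%:R * gamma t
    - 4 * expR (- (tau ^+ 2 * T0%:R / (32 * n%:R ^+ 2 * H%:R ^+ 2))) in
  (forall (t : nat) (i : 'I_n) (v : 'I_H), (T0 < t)%N -> 0 < F i v ->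
     p t <= round_cond_prob T0 F D L t
              (fun x => bids x i == values x i) (fun x => values x i == v))
  /\ p @ \oo -->
       1 - 4 * expR (- (tau ^+ 2 * T0%:R / (32 * n%:R ^+ 2 * H%:R ^+ 2))).
Proof.
set X := tau ^+ 2 * _ / _ in T0_large *; move=> p; split=> [t i v tT0 Fv|]; last first.
  have <- : 1 - H%:R * 0 - 4 * expR (- X) = 1 - 4 * expR (- X) by rewrite mulr0 subr0.
  by apply: cvgB; [apply: cvgB; [exact: cvg_cst | apply: cvgM => //; exact: cvg_cst]|exact: cvg_cst].
have H0 : 0 < H%:R :> R by rewrite ltr0n.
have H1 : 1 <= H%:R :> R by rewrite ler1n.
have n2 : 2 <= n%:R :> R by rewrite (ler_nat R 2).
have n0 : 0 < n%:R :> R by lra.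
have tau1 : tau <= 1.
  by apply: le_trans tau_le _; rewrite invf_le1 ?exprn_gt0 // exprn_ege1.
have tauX : 0 < tau <= 1 by rewrite tau_gt0 tau1.
have X_ge : 1 / 2 <= X by have := expR_ge1Dx (- X); lra.
(* Solving the definition of [X] for [T0] and using [X >= 1 / 2] and [tau <= 1]; this gives both
   [T0 > 0] and the room needed for the shift of index. *)
have T0_ge : H%:R <= T0%:R :> R.
  have <- : (32 * n%:R ^+ 2 * H%:R ^+ 2 * X) / tau ^+ 2 = T0%:R.
    by rewrite /X; field; rewrite !gt_eqF.
  rewrite ler_pdivlMr ?exprn_gt0 //; apply: (@le_trans _ _ H%:R).
    by rewrite ler_piMr // exprn_ile1 // ltW.
  have n4 : 4 <= n%:R ^+ 2 :> R by nra.
  have HH : H%:R <= H%:R ^+ 2 :> R by nra.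
  have nH : 4 * H%:R <= n%:R ^+ 2 * H%:R ^+ 2 :> R by apply: ler_pM => //; lra.
  by nra.
have T0_gt0 : (0 < T0)%N by rewrite -(ltr0n R); lra.
(* Round [u + 1] has a past of length [u], and [T0 <= u] puts it in the learning phase. *)
case: t tT0 => // u; rewrite ltnS => uT0.
rewrite round_cond_prob_truthful //=.
apply: le_trans (truthful_prob_ge n_ge2 H_gt0 T0_gt0 D_uniform L_mean_based
  tau_gt0 tau_le thick gamma_small i v uT0).
have fb := failure_bound u.+1 n_ge2 H_gt0 tauX T0_large.
(* Learning bounds round u + 1 by gamma u, the claim by gamma (u + 1): since
   u >= T0 >= H, the monotonicity of gamma t * t makes H absorb the shift. *)
suff : (H%:R - 1) * gamma u <= H%:R * gamma u.+1 by rewrite /p; move: fb; lra.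
have u0 : 0 < u%:R :> R by rewrite ltr0n (leq_trans T0_gt0).
have uH : H%:R <= u%:R :> R by apply: le_trans T0_ge _; rewrite ler_nat.
have g0 : 0 <= gamma u.+1 by exact: (mean_based_rate_ge0 n_ge2 H_gt0 D L_mean_based).
have := gamma_incr u u.+1; rewrite leqnSn -(ltr0n R) u0 => /(_ isT).
rewrite -[u.+1%:R]natr1 => gi; rewrite -(ler_pM2r u0).
apply: (@le_trans _ _ ((H%:R - 1) * (gamma u.+1 * (u%:R + 1)))).
  by rewrite -mulrA ler_wpM2l // subr_ge0.
have -> : (H%:R - 1) * (gamma u.+1 * (u%:R + 1)) =
  gamma u.+1 * ((H%:R - 1) * (u%:R + 1)) by ring.
rewrite -mulrA [leRHS]mulrCA ler_wpM2l //; nra.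
Qed.
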